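(* Let $g$ and $d$ be positive integers with $d\mid g$, and let $P_\ast=B_{H_{g/d}}(I_d)$. Then there exists a set $\mathcal{P}$ of $d$ $2$-regular $(g,g,1,g(g-1)/2)$ PDAs that are Blackburn-compatible w.r.t. $P_\ast$ and such that $L_{\mathcal{P},P_\ast}(I_d)$ is a $2d$-regular $(gd,\;gd,\;gd+d-2g+g/d,\;g(2g-d-g/d)/2)$ PDA.
   Context: Notation: $[n]=\{0,1,\dots,n-1\}$. For positive integers $K,f$, a nonnegative integer $Z$ and a finite set $\mathcal{S}$ of integers, a $(K,f,Z,\mathcal{S})$ placement delivery array (PDA) is an $f\times K$ array $P=[p_{j,k}]$ with entries in $\mathcal{S}\cup\{\ast\}$ such that: (C1) $\ast$ appears exactly $Z$ times in each column; (C2) each $s\in\mathcal{S}$ occurs at least once; (C3, Blackburn property) if two distinct cells $(j_1,k_1)$, $(j_2,k_2)$ contain the same integer then $p_{j_1,k_2}=p_{j_2,k_1}=\ast$. It is $g$-regular if each integer of $\mathcal{S}$ occurs exactly $g$ times. A number $S$ in place of the set means the integer set has $S$ elements. Blackburn compatibility: for arrays $P_0,P_1,P_\ast$ of the same size, $P_0$ and $P_1$ are Blackburn-compatible w.r.t. $P_\ast$ if, whenever $p^{(0)}_{i_1j_1}=p^{(1)}_{i_2j_2}\neq\ast$, we have $p^{(\ast)}_{i_1j_2}=p^{(\ast)}_{i_2j_1}=\ast$. A family is Blackburn-compatible w.r.t. $P_\ast$ if any two different members of the family are. $H_n$ is the symmetric $n\times n$ array with $\ast$ on the diagonal and $n(n-1)/2$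 distinct integers below the diagonal (reflected across the diagonal above it); $H_1=(\ast)$. $B_{H_{g/d}}(I_d)$ is the $g\times g$ array that is $d\times d$ block diagonal, with every diagonal block equal to the same array $H_{g/d}$ and all off-diagonal blocks all-$\ast$. Lifting of $I_d$: for $\mathcal{P}=\{P_0,\dots,P_{d-1}\}$ and $P_\ast$ of the same size, $L_{\mathcal{P},P_\ast}(I_d)$ is the $d\times d$ block array whose $i$-th diagonal block is $P_i$ and whose off-diagonal blocks are copies of $P_\ast$ with integers relabelled so that the integer sets of these copies are disjoint from each other and from the integers of $P_0,\dots,P_{d-1}$. *)

(* Defs.v *)
From HB Require Import structures.
From mathcomp Require Import all_boot all_order all_algebra.
From mathcomp Require Import finmap.

Set Implicit Arguments.
Unset Strict Implicit.
Unset Printing Implicit Defensive.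

(* [None] plays the role of the symbol "*". *)
Notation array f K := 'M[option int]_(f, K).

Definition occurs (f K : nat) (P : array f K) (s : int) : Prop :=
  exists j k, P j k = Some s.

(* As usual for PDAs, K counts columns and f counts rows. *)
Definition is_pda (K f Z : nat) (S : {fset int}) (P : array f K) : Prop :=
  [/\ (0 < K) && (0 < f),
      forall s, occurs P s -> s \in S,
      forall k : 'I_K, #|[set j : 'I_f | P j k == None]| = Z,
      forall s, s \in S -> occurs P s
    & forall (j1 j2 : 'I_f) (k1 k2 : 'I_K) (s : int),
        (j1, k1) <> (j2, k2) -> P j1 k1 = Some s -> P j2 k2 = Some s ->
        P j1 k2 = None /\ P j2 k1 = None].

Definition regular (r K f : nat) (S : {fset int}) (P : array f K) : Prop :=
  forall s, s \in S ->
    #|[set c : 'I_f * 'I_K | P c.1 c.2 == Some s]| = r.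

Definition regular_pda (r K f Z n : nat) (P : array f K) : Prop :=
  exists S : {fset int}, [/\ #|` S| = n, is_pda Z S P & regular r S P].

Definition blackburn_compatible (f K : nat) (P0 P1 Pstar : array f K) : Prop :=
  forall (i1 i2 : 'I_f) (j1 j2 : 'I_K),
    P0 i1 j1 = P1 i2 j2 -> P0 i1 j1 <> None ->
    Pstar i1 j2 = None /\ Pstar i2 j1 = None.

Definition blackburn_compatible_family (d f K : nat) (P : 'I_d -> array f K)
    (Pstar : array f K) : Prop :=
  forall a b : 'I_d, P a <> P b -> blackburn_compatible (P a) (P b) Pstar.

(* The integers of H_n are left unspecified: [is_H] holds of every labelling
   of the entries below the diagonal by distinct integers. *)
Definition is_H (n : nat) (H : array n n) : Prop :=
  [/\ forall i, H i i = None,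
      forall i j, H i j = H j i,
      forall i j : 'I_n, j < i -> H i j <> None
    & forall i j i' j' : 'I_n, j < i -> j' < i' -> H i j = H i' j' ->
        (i, j) = (i', j')].

Lemma is_H_inhabited (n : nat) : exists H : array n n, is_H H.
Proof.
exists (\matrix_(i < n, j < n) if i == j then None
        else Some (Posz (choice.pickle (maxn i j, minn i j))))%R.
split=> [i|i j|i j|i j i' j'].
- by rewrite mxE eqxx.
- by rewrite !mxE eq_sym maxnC minnC.
- by move=> lt_ji; rewrite mxE -val_eqE gtn_eqF.
move=> lt_ji lt_ji'; rewrite !mxE -!val_eqE !gtn_eqF // => -[].
move/(pcan_inj choice.pickleK).
rewrite (maxn_idPl (ltnW lt_ji)) (minn_idPr (ltnW lt_ji)).
rewrite (maxn_idPl (ltnW lt_ji')) (minn_idPr (ltnW lt_ji')).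
by case=> /val_inj -> /val_inj ->.
Qed.

Fact block_index_subproof (m d : nat) (r : 'I_(m * d)) : r %/ m < d.
Proof.
have [m0|m_gt0] := posnP m; last by rewrite ltn_divLR // (mulnC d).
by case: r => r; rewrite m0.
Qed.

Fact block_offset_subproof (m d : nat) (r : 'I_(m * d)) : r %% m < m.
Proof.
by have [m0|m_gt0] := posnP m; [case: r => r; rewrite m0 | rewrite ltn_mod].
Qed.

Definition block_index (m d : nat) (r : 'I_(m * d)) : 'I_d :=
  Ordinal (block_index_subproof r).
Definition block_offset (m d : nat) (r : 'I_(m * d)) : 'I_m :=
  Ordinal (block_offset_subproof r).

(* The d x d block array whose (u, v) block is the m x m array [B u v]. *)
Definition block_array (d m : nat) (B : 'I_d -> 'I_d -> array m m) :
    array (m * d) (m * d) :=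
  (\matrix_(r, c) B (block_index r) (block_index c)
                    (block_offset r) (block_offset c))%R.

Definition blowup_id (d m : nat) (H : array m m) : array (m * d) (m * d) :=
  block_array (fun u v : 'I_d => if u == v then H else const_mx None).

(* [rho u v] relabels the copy of [Pstar] used as the off-diagonal block
   (u, v); its values for u = v are irrelevant. *)
Definition lifting_id (d m : nat) (P : 'I_d -> array m m) (Pstar : array m m)
    (rho : 'I_d -> 'I_d -> int -> int) : array (m * d) (m * d) :=
  block_array (fun u v => if u == v then P u
                          else map_mx (omap (rho u v)) Pstar).

Definition admissible_relabelling (d m : nat) (P : 'I_d -> array m m)
    (Pstar : array m m) (rho : 'I_d -> 'I_d -> int -> int) : Prop :=
  [/\ forall u v, u <> v -> forall s t, occurs Pstar s -> occurs Pstar t ->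
        rho u v s = rho u v t -> s = t,
      forall u v u' v', u <> v -> u' <> v' -> (u, v) <> (u', v') ->
        forall s t, occurs Pstar s -> occurs Pstar t ->
        rho u v s <> rho u' v' t
    & forall u v, u <> v -> forall s, occurs Pstar s ->
        forall a, ~ occurs (P a) (rho u v s)].

(* Main.v *)
(* Write g = m d and index rows and columns by pairs (block u in Z/d, offset p
   in Z/m).  Start from any labelled array H_g.  For m > 1, P_a is H_g with the
   entries inside each diagonal block moved cyclically by a blocks, entries
   outside these blocks being unchanged.  An integer inside block u of P_a then
   lies in a different block of P_b, and an integer outside the diagonal blocks
   occupies the same two cells in all P_a, so the cross cells demanded by
   compatibility are either off the diagonal blocks or on the diagonal of P_*.
   All P_a share the same g(g-1)/2 integers; each occurs twice per P_a, hence 2d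
   times in the lifting, as do the relabelled integers of P_*.  The number of
   integers follows by double counting the non-star cells. *)

Require Import Defs.
From mathcomp Require Import all_boot all_order all_algebra.
From mathcomp Require Import finmap.
From mathcomp Require Import fingroup perm zify.

Set Implicit Arguments.
Unset Strict Implicit.
Unset Printing Implicit Defensive.

(** * Regularity without a named integer set *)

Definition blackburn (f K : nat) (P : array f K) : Prop :=
  forall (j1 j2 : 'I_f) (k1 k2 : 'I_K) (s : int),
    (j1, k1) <> (j2, k2) -> P j1 k1 = Some s -> P j2 k2 = Some s ->
    P j1 k2 = None /\ P j2 k1 = None.

Definition cells (f K : nat) (P : array f K) (x : option int) :=
  [set c : 'I_f * 'I_K | P c.1 c.2 == x].

Definition column_stars (f K : nat) (P : array f K) (k : 'I_K) :=
  [set j : 'I_f | P j k == None].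

(** These are the conditions that pass block by block through a blow-up or a lifting; the number of
    integers is recovered only at the end, from the count of non-star cells. *)
Definition uniform (r Z f K : nat) (P : array f K) : Prop :=
  [/\ forall k, #|column_stars P k| = Z,
      blackburn P
    & forall s, occurs P s -> #|cells P (Some s)| = r].

Lemma cells_eq0 (f K : nat) (P : array f K) (s : int) :
  ~ occurs P s -> #|cells P (Some s)| = 0.
Proof.
move=> nPs; apply/eqP; rewrite cards_eq0; apply/eqP/setP=> -[i j].
by rewrite !inE /=; apply/eqP=> Ps; apply: nPs; exists i, j.
Qed.

Lemma uniform_regular_pda (r Z n f K : nat) (P : array f K) :
  0 < K -> 0 < f -> 0 < r -> uniform r Z P -> K * (f - Z) = n * r ->
  regular_pda r Z n P.
Proof.
move=> K_gt0 f_gt0 r_gt0 [stars bb cnt] count_eq.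
pose S : {fset int} := seq_fset tt (pmap id [seq P c.1 c.2 | c : 'I_f * 'I_K]).
have SP s : (s \in S) <-> occurs P s.
  rewrite seq_fsetE mem_pmap map_id; split.
    by case/mapP=> -[i j] _ /= Ps; exists i, j.
  by case=> i [j Ps]; apply/mapP; exists (i, j); rewrite ?mem_enum.
have cntS s : s \in S -> #|cells P (Some s)| = r by move/SP/cnt.
exists S; split=> //; last first.
  by split=> [|s /SP|k|s /SP|] //; rewrite ?K_gt0 ?f_gt0 // stars.
(* Both sides of [count_eq] count the cells of [P] that are not stars. *)
have byS : \sum_(c : 'I_f * 'I_K | P c.1 c.2 != None) 1 = #|` S| * r.
  transitivity (\sum_(s : S) \sum_(c in cells P (Some (val s))) 1).
    rewrite (exchange_big_dep (fun c : 'I_f * 'I_K => P c.1 c.2 != None)) /=;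
      last by move=> s [i j] _; rewrite inE /= => /eqP->.
    apply: eq_bigr => -[i j] /=; case Pij: (P i j) => [s|//] _.
    have sS : s \in S by apply/SP; exists i, j.
    rewrite (bigD1 [` sS]%fset) ?inE /= ?Pij // big1 // => t.
    rewrite inE /= Pij => /andP[/eqP[st] /eqP[]]; exact/val_inj.
  rewrite (eq_bigr (fun=> r)); first by rewrite sum_nat_const -cardfE.
  by move=> s _; rewrite sum1_card; exact: cntS (fsvalP s).
have byK : \sum_(c : 'I_f * 'I_K | P c.1 c.2 != None) 1 = K * (f - Z).
  rewrite big_mkcond -(pair_bigA _ (fun i j => if P i j != None then 1 else 0)).
  rewrite exchange_big -[RHS]mulnC -[K in RHS]card_ord mulnC -sum_nat_const.
  apply: eq_bigr => k _; rewrite -big_mkcond sum1dep_card -(stars k).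
  have -> : [set j | P j k != None] = ~: column_stars P k.
    by apply/setP=> j; rewrite !inE.
  by rewrite cardsCs setCK card_ord.
by apply/eqP; rewrite -(eqn_pmul2r r_gt0) -byS byK count_eq.
Qed.

Lemma row_perm_uniform (r Z f K : nat) (s : 'S_f) (P : array f K) :
  uniform r Z P -> uniform r Z (row_perm s P).
Proof.
case=> stars bb cnt; split.
- move=> k; rewrite -(stars k) -[RHS](card_preimset _ (@perm_inj _ s)).
  by apply: eq_card => j; rewrite !inE mxE.
- move=> j1 j2 k1 k2 t neq; rewrite !mxE; apply: bb => -[/perm_inj ej ek].
  by apply: neq; rewrite ej ek.
move=> t [i [j]]; rewrite mxE => Pt; rewrite -(cnt t); last by exists (s i), j.
have inj : injective (fun c : 'I_f * 'I_K => (s c.1, c.2)).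
  by move=> [i1 j1] [i2 j2] /= [/perm_inj -> ->].
rewrite -[RHS](card_preimset _ inj).
by apply: eq_card => c; rewrite !inE mxE.
Qed.

(** An orientation-free form of [is_H]: the later arguments compare cells up to transposition and
    never ask which one lies below the diagonal. *)
Lemma is_HP (n : nat) (H : array n n) :
  is_H H <->
  [/\ forall i j, H i j = H j i,
      forall i j, (H i j == None) = (i == j)
    & forall i j i' j', i <> j -> H i j = H i' j' ->
        (i = i' /\ j = j') \/ (i = j' /\ j = i')].
Proof.
split=> [[diag sym noz inj]|[sym noz inj]]; last first.
  split=> [i|//|i j lt_ji|i j i' j' lt lt' eqH].
  - by apply/eqP; rewrite noz.
  - by apply/eqP; rewrite noz -val_eqE gtn_eqF.
  have neq : i <> j by move=> eij; rewrite eij ltnn in lt.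
  by case: (inj _ _ _ _ neq eqH) => -[? ?]; subst=> //; lia.
have nz i j : (H i j == None) = (i == j).
  have [->|neq] := eqVneq i j; first by rewrite diag.
  apply/eqP; case: (ltngtP i j) => [lt|lt|/val_inj/eqP]; last by rewrite (negPf neq).
    by rewrite sym; apply: noz.
  exact: noz.
have inj_gt (i j i' j' : 'I_n) : j < i -> H i j = H i' j' ->
    (i = i' /\ j = j') \/ (i = j' /\ j = i').
  move=> lt eqH; case: (ltngtP i' j') => [lt'|lt'|/val_inj e].
  - by right; rewrite (sym i') in eqH; case: (inj _ _ _ _ lt lt' eqH).
  - by left; case: (inj _ _ _ _ lt lt' eqH).
  by case: (noz _ _ lt); rewrite eqH e diag.
split=> // i j i' j' neq eqH; case: (ltngtP j i) => [lt|lt|/val_inj e].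
- exact: inj_gt.
- by rewrite sym in eqH; case: (inj_gt _ _ _ _ lt eqH) => -[-> ->]; auto.
by case: neq.
Qed.

(** An integer fills a cell (i, j) and its transpose, whose cross cells (i, i) and (j, j) are
    diagonal stars. *)
Lemma is_H_uniform (n : nat) (H : array n n) : is_H H -> uniform 2 1 H.
Proof.
case/is_HP=> sym nz inj; split=> [k|j1 j2 k1 k2 s neq H1 H2|s [i [j Hs]]].
- rewrite -[RHS](cards1 k); apply: eq_card => j; by rewrite !inE nz.
- have njk : j1 <> k1 by move/eqP; rewrite -nz H1.
  case: (inj _ _ _ _ njk (etrans H1 (esym H2))) => -[e1 e2].
    by case: neq; rewrite e1 e2.
  by split; apply/eqP; rewrite nz ?e1 ?e2.
have nij : i <> j by move/eqP; rewrite -nz Hs.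
have neq : (i, j) != (j, i) by apply/eqP=> -[] /nij.
transitivity #|[set (i, j); (j, i)]|; last by rewrite cards2 neq.
apply: eq_card => -[k l]; rewrite !inE /= -Hs.
apply/eqP/orP=> [/esym /(inj _ _ _ _ nij)|].
  by case=> -[-> ->]; [left|right].
by case=> /eqP[-> ->]; rewrite // sym.
Qed.

(** * Block arrays, blow-ups and liftings *)

Section Blocks.
Variables (m d : nat).

Fact block_join_subproof (u : 'I_d) (o : 'I_m) : u * m + o < m * d.
Proof.
have := ltn_ord u; have := ltn_ord o; nia.
Qed.

Definition block_join (u : 'I_d) (o : 'I_m) : 'I_(m * d) :=
  Ordinal (block_join_subproof u o).

Lemma block_index_join u o : block_index (block_join u o) = u.
Proof.
apply/val_inj; rewrite /= divnMDl ?divn_small ?addn0 //.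
exact: leq_trans (ltn_ord o).
Qed.

Lemma block_offset_join u o : block_offset (block_join u o) = o.
Proof. by apply/val_inj; rewrite /= modnMDl modn_small. Qed.

Lemma block_joinK r : block_join (block_index r) (block_offset r) = r.
Proof. by apply/val_inj; rewrite /= -divn_eq. Qed.

Lemma block_inj (r c : 'I_(m * d)) :
  block_index r = block_index c -> block_offset r = block_offset c -> r = c.
Proof. by move=> e1 e2; rewrite -(block_joinK r) e1 e2 block_joinK. Qed.

Lemma sum_blocks (F : 'I_d -> 'I_m -> nat) :
  \sum_(r < m * d) F (block_index r) (block_offset r) = \sum_u \sum_o F u o.
Proof.
rewrite pair_bigA /= (reindex (fun p => block_join p.1 p.2)) /=.
  by apply: eq_bigr => -[u o] _; rewrite block_index_join block_offset_join.
exists (fun r => (block_index r, block_offset r)) => [[u o]|r] _ /=.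
  by rewrite block_index_join block_offset_join.
exact: block_joinK.
Qed.

Lemma card_cells_block (B : 'I_d -> 'I_d -> array m m) x :
  #|cells (block_array B) x| = \sum_u \sum_v #|cells (B u v) x|.
Proof.
have cellsE f (P : array f f) :
    #|cells P x| = \sum_i \sum_j (P i j == x).
  rewrite -sum1dep_card big_mkcond pair_bigA.
  by apply: eq_bigr => c _; case: (_ == _).
rewrite cellsE.
under eq_bigr => r _ do under eq_bigr => c _ do rewrite mxE.
under eq_bigr => r _ do rewrite (sum_blocks (fun v p =>
  B (block_index r) v (block_offset r) p == x : nat)).
rewrite (sum_blocks (fun u o => \sum_v \sum_p (B u v o p == x))).
apply: eq_bigr => u _; rewrite exchange_big; apply: eq_bigr => v _.
by rewrite cellsE.
Qed.

Lemma card_column_stars_block (B : 'I_d -> 'I_d -> array m m) c :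
  #|column_stars (block_array B) c| =
  \sum_u #|column_stars (B u (block_index c)) (block_offset c)|.
Proof.
have starsE f (P : array f f) k :
    #|column_stars P k| = \sum_i (P i k == None).
  by rewrite -sum1dep_card big_mkcond; apply: eq_bigr => i _; case: (_ == _).
rewrite starsE; under eq_bigr => r _ do rewrite mxE.
rewrite (sum_blocks (fun u o =>
  B u (block_index c) o (block_offset c) == None : nat)).
by apply: eq_bigr => u _; rewrite starsE.
Qed.

Lemma occurs_block (B : 'I_d -> 'I_d -> array m m) s :
  occurs (block_array B) s <-> exists u v, occurs (B u v) s.
Proof.
split=> [[i [j]]|[u [v [i [j Bs]]]]].
  by rewrite mxE => Bs; do 4!eexists; exact: Bs.
exists (block_join u i), (block_join v j).
by rewrite mxE !block_index_join !block_offset_join.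
Qed.

(** Equal integers in one diagonal block are handled by [H]; in two different diagonal blocks their
    cross cells fall in all-star blocks. Each column meets one copy of [H] and d - 1 blocks of m
    stars. *)
Lemma blowup_uniform (r Z : nat) (H : array m m) :
  uniform r Z H -> uniform (r * d) (Z + (d - 1) * m) (blowup_id d H).
Proof.
case=> stars bb cnt; split.
- move=> c; rewrite card_column_stars_block (bigD1 (block_index c)) //= eqxx.
  rewrite stars (eq_bigr (fun=> m)) => [|u /negPf->].
    by rewrite sum_nat_const cardC1 card_ord subn1.
  rewrite -[RHS]card_ord; apply: eq_card => j.
  by rewrite !inE mxE eqxx.
- move=> i1 i2 j1 j2 s neq; rewrite !mxE.
  case: (eqVneq (block_index i1)) => [e1|_]; rewrite ?mxE // => H1.
  case: (eqVneq (block_index i2)) => [e2|_]; rewrite ?mxE // => H2.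
  rewrite e1 e2 [block_index j2 == _]eq_sym.
  case: eqP => [e|_]; rewrite ?mxE //.
  apply: bb H1 H2 => -[e3 e4]; apply: neq.
  by congr pair; apply: block_inj; by [exact: val_inj | rewrite ?e1 e ?e2].
move=> s /occurs_block[u [v]].
case: eqP => [_|_ [i [j]]]; last by rewrite mxE.
move=> /cnt Hs; rewrite card_cells_block.
rewrite (eq_bigr (fun=> r)) ?sum_nat_const ?card_ord 1?mulnC // => {}u _.
rewrite (bigD1 u) //= eqxx Hs big1 ?addn0 // => {}v.
rewrite eq_sym => /negPf->; apply: cells_eq0.
by case=> i [j]; rewrite mxE.
Qed.

(** Equal integers in two different diagonal blocks have their cross cells in copies of [Pstar],
    where compatibility puts stars. The relabelling excludes every other coincidence between
    different blocks. An integer of the diagonal occurs r times in each of the d blocks because all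
    [P a] share their integers; this matches the r * d occurrences of a relabelled integer inside
    its only block. *)
Lemma lifting_uniform (r Z Z' : nat) (P : 'I_d -> array m m)
    (Pstar : array m m) (rho : 'I_d -> 'I_d -> int -> int) :
  (forall a, uniform r Z (P a)) -> uniform (r * d) Z' Pstar ->
  (forall a b s, occurs (P a) s -> occurs (P b) s) ->
  (forall a b, a <> b -> blackburn_compatible (P a) (P b) Pstar) ->
  admissible_relabelling P Pstar rho ->
  uniform (r * d) (Z + (d - 1) * Z') (lifting_id P Pstar rho).
Proof.
move=> unifP [stars bb cnt] occP compat [rho_inj rho_disj rhoP].
split.
- move=> c; rewrite card_column_stars_block (bigD1 (block_index c)) //= eqxx.
  rewrite (eq_bigr (fun=> Z')) => [|u /negPf->].
    rewrite sum_nat_const cardC1 card_ord subn1.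
    by case: (unifP (block_index c)) => ->.
  rewrite -[RHS](stars (block_offset c)); apply: eq_card => j.
  by rewrite !inE mxE; case: (Pstar _ _).
- move=> i1 i2 j1 j2 s neq; rewrite !mxE.
  have neq_off : block_index i1 = block_index i2 ->
      block_index j1 = block_index j2 ->
      (block_offset i1, block_offset j1) <> (block_offset i2, block_offset j2).
    move=> e1 e2 [e3 e4]; apply: neq.
    by congr pair; apply: block_inj => //; apply: val_inj.
  move: neq_off {neq}.
  move: (block_index i1) (block_index i2) (block_index j1) (block_index j2).
  move: (block_offset i1) (block_offset i2) (block_offset j1) (block_offset j2).
  move=> {}i1 {}i2 {}j1 {}j2 u1 u2 v1 v2 neq.
  have relabelled u v i j : map_mx (omap (rho u v)) Pstar i j = Some s ->
      exists2 t, Pstar i j = Some t & s = rho u v t.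
    by rewrite mxE; case: (Pstar i j) => // t [<-]; exists t.
  case: (eqVneq u1 v1) => [e1|/eqP n1]; case: (eqVneq u2 v2) => [e2|/eqP n2].
  + subst v1 v2; case: (eqVneq u1 u2) neq => [->|/eqP n12] neq H1 H2.
      by case: (unifP u2) => _ bbP _; apply: bbP H1 H2; exact: neq.
    rewrite !mxE; case: (compat _ _ n12 i1 i2 j1 j2); rewrite ?H1 ?H2 //.
    by move=> -> ->.
  + move=> H1 /relabelled[t Ht es]; case: (rhoP _ _ n2 t _ u1); rewrite -?es;
      by [exists i2, j2 | exists i1, j1].
  + move=> /relabelled[t Ht es] H2; case: (rhoP _ _ n1 t _ u2); rewrite -?es;
      by [exists i1, j1 | exists i2, j2].
  move=> /relabelled[t Ht es] /relabelled[t' Ht' est]; rewrite es in est.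
  have occt : occurs Pstar t by exists i1, j1.
  have occt' : occurs Pstar t' by exists i2, j2.
  have [[eu ev]|/eqP neuv] := eqVneq (u1, v1) (u2, v2); last first.
    by case: (rho_disj _ _ _ _ n1 n2 neuv _ _ occt occt').
  subst u2 v2; have ett := rho_inj _ _ n1 _ _ occt occt' est; subst t'.
  move/eqP/negPf: n1 => ->; rewrite !mxE.
  by case: (bb _ _ _ _ _ (neq erefl erefl) Ht Ht') => -> ->.
move=> s /occurs_block[u [v]]; rewrite card_cells_block.
case: eqP => [_|nuv].
  move=> Ps; rewrite (eq_bigr (fun=> r)) ?sum_nat_const ?card_ord 1?mulnC //.
  move=> a _; rewrite (bigD1 a) //= eqxx big1 ?addn0.
    case: (unifP a) => _ _; apply; exact: occP Ps.
  move=> b; rewrite eq_sym => nab; rewrite (negPf nab); move/eqP: nab => nab.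
  apply: cells_eq0 => -[i [j]]; rewrite mxE.
  case Pt: (Pstar i j) => [t|//] [est].
  by case: (rhoP a b nab t _ u); [exists i, j | rewrite est].
case=> i [j]; rewrite mxE; case Pt: (Pstar i j) => [t|//] [<-].
have occt : occurs Pstar t by exists i, j.
rewrite pair_bigA (bigD1 (u, v)) //=; move/eqP/negPf: (nuv) => ->.
rewrite big1 ?addn0 => [|[u' v'] /= nuv'].
  rewrite -(cnt t occt); apply: eq_card => -[k l].
  rewrite !inE /= mxE; case Ptkl: (Pstar k l) => [t'|//=].
  apply/eqP/eqP=> [[]|[->]//].
  by move/(rho_inj _ _ nuv) => -> //; exists k, l.
apply: cells_eq0; case: eqP => [_|n'] occ.
  exact: rhoP nuv _ occt _ occ.
case: occ => k [l]; rewrite mxE; case Ptkl: (Pstar k l) => [t'|//] [e].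
apply: (rho_disj _ _ _ _ n' nuv) e => //; last by exists k, l.
by apply/eqP.
Qed.

Lemma admissible_relabelling_exists (P : 'I_d -> array m m)
    (Pstar : array m m) : exists rho, admissible_relabelling P Pstar rho.
Proof.
(* [N] bounds the absolute value of every integer of every [P a] (a star counts as 0), so labels
   above [N] are fresh; encoding the triple (u, v, s) keeps them distinct. *)
pose N := \max_(c : 'I_d * ('I_m * 'I_m)) absz (odflt 0%R (P c.1 c.2.1 c.2.2)).
exists (fun u v s => Posz (N.+1 + choice.pickle (nat_of_ord u, nat_of_ord v, s))).
split=> [u v _ s t _ _ [/addnI] /(pcan_inj choice.pickleK)[] //| | ].
  move=> u v u' v' _ _ neq s t _ _ [/addnI] /(pcan_inj choice.pickleK)[].
  by move=> /val_inj eu /val_inj ev _; apply: neq; rewrite eu ev.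
move=> u v _ s _ a [i [j Pa]].
have := leq_bigmax (F := fun c : 'I_d * ('I_m * 'I_m) =>
  absz (odflt 0%R (P c.1 c.2.1 c.2.2))) (a, (i, j)).
by rewrite /= Pa /= -/N; lia.
Qed.

End Blocks.

(** * The family obtained by cyclic shifts of blocks *)

Section Family.
Variables (m d : nat).
Local Notation g := (m * d.+1).
Implicit Types (i j : 'I_g) (a b : 'I_d.+1).

(** The number of blocks is a successor so that block indices form a cyclic group; the addition
    wraps around. *)
Definition shift_block a i : 'I_g :=
  block_join (block_index i + a)%R (block_offset i).

Lemma shift_blockK a : cancel (shift_block a) (shift_block (- a)%R).
Proof.
move=> i; rewrite /shift_block block_index_join block_offset_join GRing.addrK.
exact: block_joinK.
Qed.

Lemma shift_blockNK a : cancel (shift_block (- a)%R) (shift_block a).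
Proof. by move=> i; rewrite -[X in shift_block X]GRing.opprK shift_blockK. Qed.

Lemma shift_block_inj a : injective (shift_block a).
Proof. exact: can_inj (shift_blockK a). Qed.

Lemma block_index_shift a i :
  block_index (shift_block a i) = (block_index i + a)%R.
Proof. exact: block_index_join. Qed.

Lemma block_offset_shift a i : block_offset (shift_block a i) = block_offset i.
Proof. exact: block_offset_join. Qed.

Lemma shift_block_injl a b i : shift_block a i = shift_block b i -> a = b.
Proof.
by move/(congr1 (@block_index _ _)); rewrite !block_index_shift => /GRing.addrI.
Qed.

Definition shift_within_blocks (A : array g g) a : array g g :=
  (\matrix_(i, j) if block_index i == block_index j
                  then A (shift_block a i) (shift_block a j) else A i j)%R.

(** The underlying map on cells is injective, commutes with transposition and fixes the diagonal as
    a set. Shifted cells stay inside diagonal blocks, so they never collide with the unshifted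
    ones. *)
Lemma shift_within_blocks_is_H (A : array g g) a :
  is_H A -> is_H (shift_within_blocks A a).
Proof.
case/is_HP=> sym nz inj; apply/is_HP; split=> [i j|i j|i j i' j' neq].
- by rewrite !mxE eq_sym ![A _ j]sym [A _ (shift_block a j)]sym.
- by rewrite mxE; case: ifP => _; rewrite nz // (inj_eq (@shift_block_inj a)).
rewrite !mxE; case: eqP => e1; case: eqP => e2.
- have nshift : shift_block a i <> shift_block a j by move/shift_block_inj.
  by move/(inj _ _ _ _ nshift) => [] [/shift_block_inj-> /shift_block_inj->]; auto.
- have nshift : shift_block a i <> shift_block a j by move/shift_block_inj.
  move/(inj _ _ _ _ nshift) => [] [ei ej]; case: e2;
  by rewrite -ei -ej !block_index_shift e1.
- move/(inj _ _ _ _ neq) => [] [ei ej]; case: e1;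
  by rewrite ei ej !block_index_shift e2.
exact: inj.
Qed.

Lemma occurs_shift_within_blocks (A : array g g) a s :
  occurs (shift_within_blocks A a) s <-> occurs A s.
Proof.
split=> [[i [j]]|[i [j As]]].
  by rewrite mxE; case: eqP => _ As; do 2!eexists; exact: As.
have [e|n] := eqVneq (block_index i) (block_index j).
  exists (shift_block (- a)%R i), (shift_block (- a)%R j).
  by rewrite mxE !block_index_shift e eqxx !shift_blockNK.
by exists i, j; rewrite mxE (negPf n).
Qed.

Lemma occurs_row_perm (s : 'S_g) (A : array g g) t :
  occurs (row_perm s A) t <-> occurs A t.
Proof.
split=> [[i [j]]|[i [j As]]].
  by rewrite mxE => As; exists (s i), j.
by exists ((s^-1)%g i), j; rewrite mxE permKV.
Qed.

Lemma blowup_None (H : array m m) i j : is_H H ->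
  (blowup_id d.+1 H i j == None) = (block_index i == block_index j) ==> (i == j).
Proof.
case/is_HP=> _ nz _; rewrite mxE.
case: (eqVneq (block_index i)) => [e|_]; rewrite ?mxE //= nz.
by apply/eqP/eqP=> [|->//]; exact: block_inj.
Qed.

Lemma shift_within_blocks_compatible (A : array g g) (H : array m m) a b :
  is_H A -> is_H H -> a <> b ->
  blackburn_compatible (shift_within_blocks A a) (shift_within_blocks A b)
    (blowup_id d.+1 H).
Proof.
move=> /is_HP[_ nz inj] hH.
(* Exchanging the two arrays turns one cross cell into the other, so one of them suffices. *)
suff half a1 a2 i1 i2 j1 j2 : a1 <> a2 ->
    shift_within_blocks A a1 i1 j1 = shift_within_blocks A a2 i2 j2 ->
    shift_within_blocks A a1 i1 j1 <> None ->
    blowup_id d.+1 H i1 j2 = None.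
  move=> nab i1 i2 j1 j2 eq12 nN; split; first exact: half eq12 nN.
  by apply: half (esym eq12) _; rewrite -?eq12 // => /esym.
move=> na eq12 nN; apply/eqP; rewrite blowup_None //; apply/implyP=> /eqP e12.
(* Assume [i1] and [j2] share a block. If both cells are inside diagonal blocks, these are the same
   block, and equal entries force [a1 = a2]. One inside and one outside is impossible. If both are
   outside, either the cells coincide, against [e12], or they are transposed and [i1 = j2]. *)
move: eq12 nN; rewrite !mxE; case: eqP => e1; case: eqP => e2.
all: move=> eqA /eqP; rewrite nz => /eqP nA.
all: have {eqA} [[ei ej]|[ei ej]] := inj _ _ _ _ nA eqA.
- case: na; move: (congr1 (@block_index _ _) ei).
  by rewrite !block_index_shift e12 e2 => /GRing.addrI.
- case: na; move: (congr1 (@block_index _ _) ei).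
  by rewrite !block_index_shift e12 => /GRing.addrI.
- by case: e2; rewrite -ei -ej !block_index_shift e1.
- by case: e2; rewrite -ei -ej !block_index_shift e1.
- by case: e1; rewrite ei ej !block_index_shift e2.
- by case: e1; rewrite ei ej !block_index_shift e2.
- by case: e2; rewrite -ei.
by rewrite ei.
Qed.

Lemma compatible_family_exists (H : array m m) : 0 < m -> is_H H ->
  exists P : 'I_d.+1 -> array g g,
    [/\ injective P,
        forall a, uniform 2 1 (P a),
        forall a b, a <> b ->
          blackburn_compatible (P a) (P b) (blowup_id d.+1 H)
      & forall a b s, occurs (P a) s -> occurs (P b) s].
Proof.
move=> m_gt0 hH; have [A hA] := is_H_inhabited g.
have [_ nz inj] := (is_HP A).1 hA.
have [m1|m_neq1] := eqVneq m 1; last first.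
  exists (shift_within_blocks A); split.
  - move=> a b PaPb.
    have m_gt1 : 1 < m by lia.
    (* An off-diagonal cell inside block 0 detects the shift, and needs two offsets. Its transpose
       is ruled out because shifts preserve offsets. *)
    pose i : 'I_g := block_join ord0 (Ordinal m_gt0).
    pose j : 'I_g := block_join ord0 (Ordinal m_gt1).
    have offij : block_offset i <> block_offset j by rewrite !block_offset_join.
    have nij : shift_block a i <> shift_block a j.
      by move/shift_block_inj=> eij; apply: offij; rewrite eij.
    move/matrixP: PaPb => /(_ i j); rewrite !mxE !block_index_join eqxx.
    case/(inj _ _ _ _ nij) => -[]; first by move/shift_block_injl.
    by move/(congr1 (@block_offset _ _)); rewrite !block_offset_shift.
  - by move=> a; apply: is_H_uniform; exact: shift_within_blocks_is_H.
  - by move=> a b; exact: shift_within_blocks_compatible.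
  by move=> a b s /occurs_shift_within_blocks/occurs_shift_within_blocks; apply.
(* Here P_* has no integer, so compatibility is vacuous, while
   [shift_within_blocks A a] does not depend on [a]: distinct members are
   obtained by moving the stars instead. *)
exists (fun a => row_perm (perm (@shift_block_inj a)) A); split.
- move=> a b /matrixP PaPb.
  (* In row [i], member [a] has its only star in column [shift_block a i], which determines [a]. *)
  pose i : 'I_g := block_join ord0 (Ordinal m_gt0).
  have := PaPb i (shift_block a i); rewrite !mxE !permE.
  have /eqP -> : A (shift_block a i) (shift_block a i) == None by rewrite nz.
  move/esym/eqP.
  by rewrite nz => /eqP /shift_block_injl.
- by move=> a; apply: row_perm_uniform; exact: is_H_uniform.
- move=> a b _ i1 i2 j1 j2 _ _.
  have star i j : blowup_id d.+1 H i j = None.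
    apply/eqP; rewrite blowup_None //; apply/implyP=> /eqP eij.
    apply/eqP; apply: block_inj eij _; apply/val_inj.
    by case: (block_offset i) (block_offset j) => [x xm] [y ym] /=; lia.
  by rewrite !star.
by move=> a b s /occurs_row_perm/occurs_row_perm; apply.
Qed.

End Family.

(** * Parameter count and assembly *)

Lemma lifting_arith (m d : nat) : 0 < m ->
  let g := m * d.+1 in
  let Z := 1 + (d.+1 - 1) * (1 + (d.+1 - 1) * m) in
  g * d.+1 + d.+1 + m - 2 * g = Z /\
  g * d.+1 * (g * d.+1 - Z) = (g * (2 * g - d.+1 - m)) %/ 2 * (2 * d.+1).
Proof.
(* From here the block size is [m.+1]. [x] is the number of non-star cells per column, written
   without truncated subtraction. *)
case: m => // m _ g Z; pose x := 2 * (m * d) + m + d.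
have -> : 2 * g = x + m.+1 + d.+1 by rewrite /g /x; lia.
have -> : g * d.+1 = x + Z by rewrite /g /x /Z !subn1 /=; lia.
have -> : x + Z + d.+1 + m.+1 = Z + (x + m.+1 + d.+1) by lia.
split; first by rewrite addnK.
(* The halving is exact: if [x] is odd, one of [m] and [d] is odd, and then g = (m + 1)(d + 1) is
   even. *)
rewrite !addnK mulnA divnK; last first.
  by rewrite dvdn2 /g /x !(oddM, oddD) /=; case: (odd m); case: (odd d).
have <- : g * d.+1 = x + Z by rewrite /g /x /Z !subn1 /=; lia.
by rewrite mulnAC.
Qed.

Theorem lemma19 (g d : nat) (hg : 0 < g) (hd : 0 < d) (hdg : d %| g)
    (H : array (g %/ d) (g %/ d)) (hH : is_H H) :
  let Pstar : array g g :=
    castmx (divnK hdg, divnK hdg) (blowup_id d H) in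
  exists P : 'I_d -> array g g,
    [/\ injective P,
        forall a : 'I_d, @regular_pda 2 g g 1 ((g * (g - 1)) %/ 2) (P a),
        blackburn_compatible_family P Pstar,
        exists rho : 'I_d -> 'I_d -> int -> int,
          admissible_relabelling P Pstar rho
      & forall rho : 'I_d -> 'I_d -> int -> int,
          admissible_relabelling P Pstar rho ->
          @regular_pda (2 * d) (g * d) (g * d)
            (* regrouped so that truncated subtraction comes last *)
            (g * d + d + g %/ d - 2 * g)
            ((g * (2 * g - d - g %/ d)) %/ 2)
            (lifting_id P Pstar rho)].
Proof.
move: (divnK hdg) H hH; move: (g %/ d) => m E H hH.
(* Replacing g by m * d throughout makes the cast an identity. *)
case: _ / E hg {hdg} => g_gt0 Pstar; rewrite {}/Pstar castmx_id.
case: d hd g_gt0 => // d' _ g_gt0 /=.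
have m_gt0 : 0 < m by case: m g_gt0 {H hH}.
have [P [injP unifP compP occP]] := compatible_family_exists d' m_gt0 hH.
exists P; split=> // [a|a b nPab||rho rhoP].
- apply: uniform_regular_pda (unifP a) _ => //.
  by rewrite divnK // dvdn2 oddM oddB // addbT andbN.
- by apply: compP => eab; apply: nPab; rewrite eab.
- exact: admissible_relabelling_exists.
have unifPstar := blowup_uniform d'.+1 (is_H_uniform hH).
have unif := lifting_uniform unifP unifPstar occP compP rhoP.
have [starsE intsE] := lifting_arith d' m_gt0.
rewrite starsE.
by apply: uniform_regular_pda unif intsE; rewrite ?muln_gt0 ?m_gt0.
Qed.
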